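(* Let $G$ be a graph (loops allowed) with finite vertex set $V$, and let $\varphi$ be a finite sequence of local complementation, edge complementation and loop complementation operations applicable to $G$. Then $G\varphi = G+X*Y+Z$ for some $X,Y,Z\subseteq V$ with $X\subseteq Y$ (in particular, $*Y$ is applicable to $G+X$).
   Context: Graphs are finite, undirected, without parallel edges, loops allowed; a graph $G$ with vertex set $V$ is identified with its adjacency matrix, a symmetric $V\times V$-matrix over $\mathbb{F}_2$ whose diagonal entry at $u$ is $1$ iff $u$ has a loop. $G[X]$ is the induced subgraph (principal submatrix) on $X$, with $\det G[\varnothing]=1$. Operations are written postfix and associate to the left. Loop complementation $G+X$ ($X\subseteq V$): add $1$ to each diagonal entry indexed by an element of $X$; it is always applicable. Pivot $G*X$ is defined (applicable) iff $\det G[X]=1$ over $\mathbb{F}_2$. In that case, writing $G=\begin{pmatrix} P & Q \\ R & S \end{pmatrix}$ with $P=G[X]$, $$G*X=\begin{pmatrix} P^{-1} & P^{-1} Q \\ R P^{-1} & S + R P^{-1} Q \end{pmatrix},$$ again a symmetric matrix over $\mathbb{F}_2$. Local complementation is the pivot $G*\{u\}$ where $u$ is a vertex with a loop. Edge complementation is the pivot $G*\{u,v\}$ where $\{u,v\}$ is an edge between distinct vertices $u,v$ both without a loop. A sequence of operations is applicable to $G$ if each operation is applicable to the graph resulting from the previous ones. *)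

(* Defs.v *)
From mathcomp Require Import all_boot all_order all_algebra.

Set Implicit Arguments.
Unset Strict Implicit.
Unset Printing Implicit Defensive.
Import GRing.Theory.
Local Open Scope ring_scope.

(* Finite undirected graph, loops allowed, given by its adjacency matrix over
   GF(2); [G (u, u) = 1] means that [u] has a loop.  Symmetry is a boolean, so
   equality of graphs is equality of adjacency matrices. *)
Record graph (V : finType) := Graph {
  adj :> {ffun V * V -> 'F_2};
  adj_symb : [forall u, forall v, adj (u, v) == adj (v, u)]
}.

Lemma graph_eqP (V : finType) (G H : graph V) : adj G = adj H -> G = H.
Proof.
case: G H => [g sg] [h sh] /= e; case: h / e sh => sh.
by rewrite (bool_irrelevance sg sh).
Qed.

Lemma adj_sym (V : finType) (G : graph V) (u v : V) : G (u, v) = G (v, u).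
Proof. by apply/eqP/(forallP (forallP (adj_symb G) u)). Qed.

Definition submatrix (V : finType) (G : graph V) (A B : {set V}) :
    'M['F_2]_(#|A|, #|B|) :=
  \matrix_(i, j) G (enum_val i, enum_val j).

Definition induced (V : finType) (G : graph V) (X : {set V}) : 'M['F_2]_#|X| :=
  submatrix G X X.

Lemma submatrix_tr (V : finType) (G : graph V) (A B : {set V}) :
  (submatrix G A B)^T = submatrix G B A.
Proof. by apply/matrixP => i j; rewrite !mxE adj_sym. Qed.

Definition loop_compl_adj (V : finType) (G : graph V) (X : {set V}) :
    {ffun V * V -> 'F_2} :=
  [ffun p => G p + ((p.1 == p.2) && (p.1 \in X))%:R].

Lemma loop_compl_sym (V : finType) (G : graph V) (X : {set V}) :
  [forall u, forall v, loop_compl_adj G X (u, v) == loop_compl_adj G X (v, u)].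
Proof.
apply/forallP => u; apply/forallP => v; apply/eqP.
rewrite !ffunE /= adj_sym eq_sym.
by case: eqP => [->|].
Qed.

Definition loop_compl (V : finType) (G : graph V) (X : {set V}) : graph V :=
  Graph (loop_compl_sym G X).

Lemma mem_dec (V : finType) (X : {set V}) (u : V) :
  {u \in X} + {u \in ~: X}.
Proof. by rewrite in_setC; case: (u \in X); [left | right]. Defined.

(* Position of [u] when [V] is listed as [X] followed by its complement, so
   that a 2 x 2 block matrix can be read as a V x V matrix. *)
Definition block_pos (V : finType) (X : {set V}) (u : V) :
    'I_(#|X| + #|~: X|) :=
  unsplit (match mem_dec X u with
           | left uX => inl (enum_rank_in uX u)
           | right uX => inr (enum_rank_in uX u)
           end).

Definition pivot_block (V : finType) (G : graph V) (X : {set V}) :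
    'M['F_2]_(#|X| + #|~: X|) :=
  let P := induced G X in
  let Q := submatrix G X (~: X) in
  let R := submatrix G (~: X) X in
  let S := submatrix G (~: X) (~: X) in
  block_mx (invmx P)        (invmx P *m Q)
           (R *m invmx P)   (S + R *m invmx P *m Q).

Definition pivot_adj (V : finType) (G : graph V) (X : {set V}) :
    {ffun V * V -> 'F_2} :=
  [ffun p => pivot_block G X (block_pos X p.1) (block_pos X p.2)].

Lemma pivot_sym (V : finType) (G : graph V) (X : {set V}) :
  [forall u, forall v, pivot_adj G X (u, v) == pivot_adj G X (v, u)].
Proof.
apply/forallP => u; apply/forallP => v; apply/eqP; rewrite !ffunE /=.
have e : (pivot_block G X)^T = pivot_block G X.
  rewrite /pivot_block tr_block_mx linearD /= !trmx_mul !trmx_inv.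
  by rewrite /induced !submatrix_tr mulmxA.
by rewrite -[in LHS]e mxE.
Qed.

(* Total function; it is meaningful only when [pivotable G X] holds, since
   [invmx] of a singular matrix is a junk value. *)
Definition pivot (V : finType) (G : graph V) (X : {set V}) : graph V :=
  Graph (pivot_sym G X).

Definition pivotable (V : finType) (G : graph V) (X : {set V}) : bool :=
  \det (induced G X) == 1.

Inductive operation (V : finType) :=
  | LocalCompl of V
  | EdgeCompl of V & V
  | LoopCompl of {set V}.

Definition applicable (V : finType) (G : graph V) (o : operation V) : bool :=
  match o with
  | LocalCompl u => G (u, u) == 1
  | EdgeCompl u v =>
      [&& u != v, G (u, v) == 1, G (u, u) == 0 & G (v, v) == 0]
  | LoopCompl _ => true
  end.

Definition apply_op (V : finType) (G : graph V) (o : operation V) : graph V :=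
  match o with
  | LocalCompl u => pivot G [set u]
  | EdgeCompl u v => pivot G [set u; v]
  | LoopCompl X => loop_compl G X
  end.

Fixpoint applicable_seq (V : finType) (G : graph V) (s : seq (operation V)) :
    bool :=
  if s is o :: s' then applicable G o && applicable_seq (apply_op G o) s'
  else true.

Definition apply_seq (V : finType) (G : graph V) (s : seq (operation V)) :
    graph V :=
  foldl (@apply_op V) G s.

(* Main.v *)
(** A graph [G] is determined by the Lagrangian space of pairs [(x, G x)] in
    [F_2^V x F_2^V].  Complementing a loop at [u] acts on this space by the
    shear [(a, b) |-> (a, a + b)] of the coordinate pair at [u], and pivoting
    swaps the coordinate pairs of the pivoted vertices.  At each vertex the two
    generate a copy of S_3, whose six elements are exactly the products
    shear^i swap^j shear^k with [i <= j]; this yields [X \subset Y] and [Z].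
    The pivot on [Y] is applicable since the swapped space is again that of a
    graph, which forces the kernel of [(G + X)[Y]] to vanish. *)
Require Import Defs.
From mathcomp Require Import all_boot all_order all_algebra.

Set Implicit Arguments.
Unset Strict Implicit.
Unset Printing Implicit Defensive.
Import GRing.Theory.
Local Open Scope ring_scope.

(** * Shears and swaps of one coordinate pair *)

Lemma F2_addxx (x : 'F_2) : x + x = 0.
Proof. by case: x => [[|[|]]] // i; apply/val_inj. Qed.

Definition shear (b : bool) (p : 'F_2 * 'F_2) :=
  if b then (p.1, p.1 + p.2) else p.

Definition swap (b : bool) (p : 'F_2 * 'F_2) := if b then (p.2, p.1) else p.

Lemma shearK b : involutive (shear b).
Proof. by case: b => -[x y] //=; rewrite /shear /= addrA F2_addxx add0r. Qed.

Lemma swapK b : involutive (swap b).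
Proof. by case: b => -[x y]. Qed.

(** The first component of [t] governs the shear applied first. Under [t.1.1 ==> t.1.2], six triples
    remain, one for each element of S_3. *)
Definition normal_form (t : bool * bool * bool) (p : 'F_2 * 'F_2) :=
  shear t.2 (swap t.1.2 (shear t.1.1 p)).

(** Shears cancel in pairs: a shear applied first toggles the initial shear if a swap follows, and
    otherwise merges with the final one. *)
Lemma normal_form_shear (t : bool * bool * bool) (d : bool) :
  t.1.1 ==> t.1.2 ->
  exists2 t' : bool * bool * bool, t'.1.1 ==> t'.1.2 &
    forall p, normal_form t' p = normal_form t (shear d p).
Proof.
case: t d => [[[] []] c] [] // _.
- by exists (false, true, c) => // p; rewrite -{1}[p](shearK true).
- by exists (true, true, c).
- by exists (true, true, c).
- by exists (false, true, c).
- exists (false, false, ~~ c) => // p.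
  by case: c => //; rewrite -{1}[p](shearK true).
- by exists (false, false, c).
Qed.

Lemma normal_form_swap (t : bool * bool * bool) (d : bool) :
  t.1.1 ==> t.1.2 ->
  exists2 t' : bool * bool * bool, t'.1.1 ==> t'.1.2 &
    forall p, normal_form t' p = normal_form t (swap d p).
Proof.
case: t d => [[[] []] c] [] // _.
- (* the braid relation: shear swap shear = swap shear swap *)
  exists (true, true, ~~ c) => // -[x y].
  rewrite /normal_form /shear /swap /=.
  case: c => /=; rewrite ?(addrC y x) //.
    by rewrite -addrA F2_addxx addr0.
  by rewrite addrAC F2_addxx add0r.
- by exists (true, true, c).
- by exists (false, false, c) => // -[].
- by exists (false, true, c).
- by exists (false, true, c).
- by exists (false, false, c).
Qed.

(** * Graphs as spaces of pairs, and maps between these spaces *)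

Section Lagrangian.
Variable V : finType.
Implicit Types (G H K : graph V) (A X Y Z : {set V}) (x : {ffun V -> 'F_2}).

Definition graph_mul G x : {ffun V -> 'F_2} :=
  [ffun u => \sum_v G (u, v) * x v].

Lemma graph_mul_inj G H : graph_mul G =1 graph_mul H -> G = H.
Proof.
move=> eGH; apply/graph_eqP/ffunP => -[u v].
have e K : graph_mul K [ffun w => (w == v)%:R] u = K (u, v).
  rewrite ffunE (bigD1 v) //= ffunE eqxx mulr1 big1 ?addr0 // => w /negPf nwv.
  by rewrite ffunE nwv mulr0.
by rewrite -e eGH e.
Qed.

(* [g] acts on the coordinate pair at each vertex; this says that it carries
   the space [{(x, G x)}] into [{(x, H x)}]. *)
Definition carries (g : V -> 'F_2 * 'F_2 -> 'F_2 * 'F_2) G H :=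
  forall x, graph_mul H [ffun u => (g u (x u, graph_mul G x u)).1] =
            [ffun u => (g u (x u, graph_mul G x u)).2].

Lemma eq_carries g h G H :
  (forall u p, g u p = h u p) -> carries g G H -> carries h G H.
Proof.
move=> egh gGH x; transitivity [ffun u => (g u (x u, graph_mul G x u)).2].
  by rewrite -gGH; congr graph_mul; apply/ffunP => u; rewrite !ffunE egh.
by apply/ffunP => u; rewrite !ffunE egh.
Qed.

Lemma carries_comp g h G H K :
  carries g G H -> carries h H K -> carries (fun u p => h u (g u p)) G K.
Proof.
move=> gGH hHK x; have := hHK [ffun u => (g u (x u, graph_mul G x u)).1].
rewrite gGH => e.
transitivity (graph_mul K [ffun u => (h u
   ([ffun u => (g u (x u, graph_mul G x u)).1] u,
    [ffun u => (g u (x u, graph_mul G x u)).2] u)).1]).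
  by congr graph_mul; apply/ffunP => u; rewrite !ffunE -surjective_pairing.
by rewrite e; apply/ffunP => u; rewrite !ffunE -surjective_pairing.
Qed.

Lemma loop_complK X : involutive (fun G => loop_compl G X).
Proof.
by move=> G; apply/graph_eqP/ffunP => p; rewrite !ffunE -addrA F2_addxx addr0.
Qed.

(** Adding 1 to the diagonal on [X] adds [x u] to the entry of [G x] at each [u] in [X], which is
    the shear there. *)
Lemma carries_loop_compl G X :
  carries (fun u => shear (u \in X)) G (loop_compl G X).
Proof.
move=> x; apply/ffunP => u; rewrite !ffunE.
have -> : (shear (u \in X) (x u, \sum_v G (u, v) * x v)).2
    = \sum_v G (u, v) * x v + (u \in X)%:R * x u.
  by rewrite /shear; case: (u \in X); rewrite /= ?mul1r ?mul0r ?addr0 // addrC.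
have fst_shear b p : (shear b p).1 = p.1 by case: b.
under eq_bigr => v _ do rewrite !ffunE fst_shear /= mulrDl.
rewrite big_split /=; congr (_ + _).
rewrite (bigD1 u) //= eqxx big1 ?addr0 // => v /negPf.
by rewrite eq_sym => ->; rewrite mul0r.
Qed.

(** * Block products and the pivot as a swap *)

Definition subcol A x : 'cV['F_2]_#|A| := \col_i x (enum_val i).

Lemma subcol_inj A x1 x2 :
  subcol A x1 = subcol A x2 -> {in A, x1 =1 x2}.
Proof.
move=> /matrixP e u uA; have := e (enum_rank_in uA u) 0.
by rewrite !mxE enum_rankK_in.
Qed.

Lemma eq_subcol A x1 x2 : {in A, x1 =1 x2} -> subcol A x1 = subcol A x2.
Proof. by move=> e; apply/matrixP => i j; rewrite !mxE e ?enum_valP. Qed.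

Lemma subcol_graph_mul G A X x :
  subcol A (graph_mul G x) =
  submatrix G A X *m subcol X x + submatrix G A (~: X) *m subcol (~: X) x.
Proof.
apply/matrixP => i j; rewrite !mxE ffunE (bigID (mem X)) /=.
rewrite [in LHS]big_enum_val /=; congr (_ + _).
  by apply: eq_bigr => k _; rewrite !mxE.
under eq_bigl => v do rewrite -in_setC.
by rewrite [in LHS]big_enum_val; apply: eq_bigr => k _; rewrite !mxE.
Qed.

Lemma block_pos_in X (i : 'I_#|X|) :
  block_pos X (enum_val i) = lshift #|~: X| i.
Proof.
rewrite /block_pos; case: mem_dec => h /=; first by rewrite enum_valK_in.
by case/setCP: (h); apply: enum_valP.
Qed.

Lemma block_pos_notin X (i : 'I_#|~: X|) :
  block_pos X (enum_val i) = rshift #|X| i.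
Proof.
rewrite /block_pos; case: mem_dec => h /=; last by rewrite enum_valK_in.
by have := enum_valP i; rewrite in_setC h.
Qed.

Definition block_posE := (block_pos_in, block_pos_notin).

Lemma pivot_submatrix G X (P := induced G X) (Q := submatrix G X (~: X))
    (R := submatrix G (~: X) X) (S := submatrix G (~: X) (~: X)) :
  [/\ submatrix (pivot G X) X X = invmx P,
      submatrix (pivot G X) X (~: X) = invmx P *m Q,
      submatrix (pivot G X) (~: X) X = R *m invmx P
    & submatrix (pivot G X) (~: X) (~: X) = S + R *m invmx P *m Q].
Proof.
split; apply/matrixP => i j; rewrite mxE ffunE /= !block_posE.
- exact: block_mxEul.
- exact: block_mxEur.
- exact: block_mxEdl.
- exact: block_mxEdr.
Qed.

(** With y = G x and C the complement of [X], solving y_X = P x_X + Q x_C for x_X gives the first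
    block row of the pivot; substituting into y_C = R x_X + S x_C gives the second. Signs vanish in
    characteristic 2. *)
Lemma carries_pivot G X :
  pivotable G X -> carries (fun u => swap (u \in X)) G (pivot G X).
Proof.
move=> /eqP detP x.
have Pu : induced G X \in unitmx by rewrite unitmxE detP unitr1.
set x' := [ffun u => _]; set y' := [ffun u => _].
have [eXX eXC eCX eCC] := pivot_submatrix G X.
have x'X : subcol X x' = subcol X (graph_mul G x).
  by apply: eq_subcol => u uX; rewrite ffunE uX.
have x'C : subcol (~: X) x' = subcol (~: X) x.
  by apply: eq_subcol => u; rewrite in_setC ffunE => /negPf ->.
have y'X : subcol X y' = subcol X x.
  by apply: eq_subcol => u uX; rewrite ffunE uX.
have y'C : subcol (~: X) y' = subcol (~: X) (graph_mul G x).
  by apply: eq_subcol => u; rewrite in_setC ffunE => /negPf ->.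
have F2mx m (M : 'cV['F_2]_m) : M + M = 0.
  by apply/matrixP => i j; rewrite !mxE F2_addxx.
have solveX : invmx (induced G X) *m subcol X (graph_mul G x)
    + invmx (induced G X) *m submatrix G X (~: X) *m subcol (~: X) x
    = subcol X x.
  rewrite (subcol_graph_mul G X X) mulmxDr !mulmxA -/(induced G X).
  by rewrite mulVmx // mul1mx -addrA F2mx addr0.
have eX : subcol X (graph_mul (pivot G X) x') = subcol X y'.
  by rewrite (subcol_graph_mul _ _ X) eXX eXC x'X x'C y'X.
have eC : subcol (~: X) (graph_mul (pivot G X) x') = subcol (~: X) y'.
  rewrite (subcol_graph_mul _ _ X) eCX eCC x'X x'C y'C.
  rewrite mulmxDl addrCA -!mulmxA -mulmxDr mulmxA solveX addrC.
  by rewrite -subcol_graph_mul.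
apply/ffunP => u; have [uX|uX] := boolP (u \in X).
  exact: (subcol_inj eX).
by apply: (subcol_inj eC); rewrite in_setC.
Qed.

(** * Applicability and uniqueness of pivots *)

(** The hypothesis is a trivial kernel of [G[X]], phrased with vectors on [V] supported in [X]; over
    F_2 a nonzero determinant equals 1. *)
Lemma pivotable_inj G X :
  (forall x, (forall u, u \notin X -> x u = 0) ->
     {in X, forall u, graph_mul G x u = 0} -> x = 0) ->
  pivotable G X.
Proof.
move=> inj; suff : induced G X \in unitmx.
  rewrite unitmxE unitfE /pivotable.
  by case: (\det _) => [[|[|]]].
(* [kermx] is a left kernel, so the transpose is taken to reach column vectors killed by
   [induced G X]. *)
rewrite -unitmx_tr -row_free_unit -kermx_eq0; apply/eqP/row_matrixP => i.
set r := row i _; have : r *m (induced G X)^T = 0.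
  by apply/sub_kermxP; apply: row_sub.
move=> /(congr1 trmx); rewrite trmx_mul trmxK trmx0 row0 => Pr0.
(* The kernel vector [r], extended by zero outside [X]. *)
pose x : {ffun V -> 'F_2} := [ffun u =>
  if mem_dec X u is left uX then r 0 (enum_rank_in uX u) else 0].
have xX : subcol X x = r^T.
  apply/matrixP => j k; rewrite (ord1 k) !mxE ffunE.
  case: mem_dec => h; first by rewrite enum_valK_in ?mxE.
  by case/setCP: (h); apply: enum_valP.
have xC u : u \notin X -> x u = 0.
  by move=> uX; rewrite ffunE; case: mem_dec => // h; rewrite h in uX.
have zero A : subcol A 0 = 0 by apply/matrixP => j k; rewrite !mxE ffunE.
have x0 : x = 0.
  apply: inj => // u uX.
  have -> : 0 = (0 : {ffun V -> 'F_2}) u by rewrite ffunE.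
  apply: (subcol_inj (A := X)) uX.
  rewrite (subcol_graph_mul _ _ X) xX [submatrix G X X *m _]Pr0 zero add0r.
  rewrite (eq_subcol (x2 := 0)) ?zero ?mulmx0 // => v.
  by rewrite in_setC => /xC ->; rewrite ffunE.
by apply: trmx_inj; rewrite -xX x0 zero trmx0.
Qed.

(** In the space of [H] the first coordinates determine the second ones, hence the whole swapped
    pair, and swapping back recovers [x]. *)
Lemma carries_swap_inj G H Y :
  carries (fun u => swap (u \in Y)) G H ->
  injective (fun x : {ffun V -> 'F_2} =>
    [ffun u => (swap (u \in Y) (x u, graph_mul G x u)).1] : {ffun V -> 'F_2}).
Proof.
move=> cGH x1 x2 e1; have := cGH x1; rewrite e1 cGH => e2; apply/ffunP => u.
have : swap (u \in Y) (x1 u, graph_mul G x1 u)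
    = swap (u \in Y) (x2 u, graph_mul G x2 u).
  move: e1 e2 => /ffunP/(_ u) + /ffunP/(_ u); rewrite !ffunE => e1 e2.
  by rewrite [LHS]surjective_pairing e1 -e2 -surjective_pairing.
by move=> /(inv_inj (swapK _)) [].
Qed.

Lemma graph_mul0 G : graph_mul G 0 = 0.
Proof.
by apply/ffunP => u; rewrite !ffunE big1 // => v _; rewrite ffunE mulr0.
Qed.

(** A kernel vector of [G[Y]], extended by zero, has all first coordinates zero after the swap on
    [Y], so by injectivity it is zero. *)
Lemma carries_swap_pivotable G H Y :
  carries (fun u => swap (u \in Y)) G H -> pivotable G Y.
Proof.
move=> cGH; apply: pivotable_inj => x xC xY; apply: (carries_swap_inj cGH).
apply/ffunP => u; rewrite [LHS]ffunE [RHS]ffunE graph_mul0.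
by case: (boolP (u \in Y)) => uY /=; rewrite ?xY ?xC // ffunE.
Qed.

Lemma carries_swap_pivot G H Y :
  carries (fun u => swap (u \in Y)) G H -> H = pivot G Y.
Proof.
move=> cGH; have cGP := carries_pivot (carries_swap_pivotable cGH).
apply: graph_mul_inj => z.
(* An injective self-map of a finite set is onto, so every vector [z] occurs as a first coordinate,
   where both graphs give the same second coordinate. *)
have [f _ fK] := injF_bij (carries_swap_inj cGH).
by rewrite -[z]fK cGH cGP.
Qed.

Lemma pivotable_local G u : G (u, u) = 1 -> pivotable G [set u].
Proof.
move=> Guu; apply: pivotable_inj => x xC /(_ u (set11 u)).
rewrite ffunE (bigD1 u) //= Guu mul1r big1 => [|v vu]; last first.
  by rewrite xC ?mulr0 // inE.
rewrite addr0 => xu; apply/ffunP => v; rewrite ffunE.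
by have [->|vu] := eqVneq v u; last by rewrite xC // inE.
Qed.

Lemma pivotable_edge G u v :
  u != v -> G (u, v) = 1 -> G (u, u) = 0 -> G (v, v) = 0 ->
  pivotable G [set u; v].
Proof.
move=> uv Guv Guu Gvv; apply: pivotable_inj => x xC xY.
have mulE w : graph_mul G x w = G (w, u) * x u + G (w, v) * x v.
  rewrite ffunE (bigD1 u) //= (bigD1 v) 1?eq_sym //= big1 ?addr0 // => z.
  by case/andP => zu zv; rewrite xC ?mulr0 // !inE negb_or zu.
have := xY u (set21 u v); rewrite mulE Guu Guv mul0r mul1r add0r => xv.
have := xY v (set22 u v); rewrite mulE Gvv adj_sym Guv mul0r mul1r addr0 => xu.
apply/ffunP => w; rewrite ffunE.
by have [->//|wu] := eqVneq w u; have [->//|wv] := eqVneq w v;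
  rewrite xC // !inE negb_or wu.
Qed.

(** * Normal forms for sequences of operations *)

Definition normalizable G H :=
  exists2 t : V -> bool * bool * bool,
    forall u, (t u).1.1 ==> (t u).1.2 & carries (fun u => normal_form (t u)) G H.

(** Prepending one operation precomposes the map at each vertex with [g], and the new triple can be
    chosen vertex by vertex. *)
Lemma normalizable_comp (g : bool -> 'F_2 * 'F_2 -> 'F_2 * 'F_2) X G H K :
  (forall (t : bool * bool * bool) d, t.1.1 ==> t.1.2 ->
     exists2 t' : bool * bool * bool, t'.1.1 ==> t'.1.2 &
       forall p, normal_form t' p = normal_form t (g d p)) ->
  carries (fun u => g (u \in X)) G H -> normalizable H K -> normalizable G K.
Proof.
move=> normal cGH [t tn cHK].
have [t' t'n t'E] := fin_all_exists2 (fun u => normal (t u) (u \in X) (tn u)).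
exists t' => //; apply: eq_carries (carries_comp cGH cHK) => u p.
by rewrite t'E.
Qed.

Lemma normalizable_apply_seq G (phi : seq (operation V)) :
  applicable_seq G phi -> normalizable G (apply_seq G phi).
Proof.
elim: phi G => [|o phi IH] G /=.
  move=> _; exists (fun=> (false, false, false)) => // x.
  transitivity (graph_mul G x); last by apply/ffunP => u; rewrite [RHS]ffunE.
  by congr graph_mul; apply/ffunP => u; rewrite ffunE.
move=> /andP[ok /IH]; case: o ok => [u|u v|X] /=.
- move=> /eqP Guu; apply: (normalizable_comp normal_form_swap).
  exact/carries_pivot/pivotable_local.
- move=> /and4P[uv /eqP Guv /eqP Guu /eqP Gvv].
  apply: (normalizable_comp normal_form_swap).
  exact/carries_pivot/pivotable_edge.
- move=> _; apply: (normalizable_comp normal_form_shear).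
  exact: carries_loop_compl.
Qed.

End Lagrangian.

Theorem corollary15 (V : finType) (G : graph V) (phi : seq (operation V)) :
  applicable_seq G phi ->
  exists X Y Z : {set V},
    [/\ X \subset Y,
        pivotable (loop_compl G X) Y
      & apply_seq G phi = loop_compl (pivot (loop_compl G X) Y) Z].
Proof.
move=> /normalizable_apply_seq [t tn]; set H := apply_seq G phi => cGH.
(* The sets collect the vertices with an initial shear, a swap and a final shear; the condition on
   [t] becomes [X \subset Y]. *)
pose X := [set u | (t u).1.1]; pose Y := [set u | (t u).1.2].
pose Z := [set u | (t u).2].
(* Going from [G + X] through [G] and [H] to [H + Z] cancels both outer shears, leaving only the
   swaps on [Y]. *)
have cY : carries (fun u => swap (u \in Y)) (loop_compl G X) (loop_compl H Z).
  have := carries_loop_compl (loop_compl G X) X; rewrite loop_complK => cX.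
  apply: eq_carries
    (carries_comp cX (carries_comp cGH (carries_loop_compl H Z))) => u p.
  by rewrite !inE /normal_form !shearK.
exists X, Y, Z; split.
- by apply/subsetP => u; rewrite !inE; apply/implyP.
- exact: carries_swap_pivotable cY.
- by rewrite -(carries_swap_pivot cY) loop_complK.
Qed.
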